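(* Let $E_0,E,X,U$ be Banach spaces, $Z=X\times U$, $Q\subset E$ nonempty closed convex, and let $I\colon Z\to\mathbb{R}^m$, $F\colon Z\to E_0$, $G\colon Z\to E$. Consider (MP2): minimize $I(x,u)$ with respect to $\mathbb{R}^m_+$ subject to $F(x,u)=0$ and $G(x,u)\in Q$; let $D=\{z\in Z:F(z)=0\}$. Let $z_0=(x_0,u_0)$ be feasible for (MP2) and assume: (A1) there are $r_1,r_1'>0$ such that $I,F,G$ are twice continuously Fréchet differentiable on $B_X(x_0,r_1)\times B_U(u_0,r_1')$; (A2) $F_x(z_0)\colon X\to E_0$ is bijective; (A3) $\nabla G(z_0)(T(D;z_0))=E$. If $z_0$ is a locally weak Pareto solution of (MP2), then for each $d\in\mathcal{C}_2(z_0)$ there exists a triple $(\lambda,v^*,e^* )\in\Lambda_2(z_0)$ such that $\langle\lambda,\nabla^2 I(z_0)(d,d)\rangle+\langle v^*,\nabla^2F(z_0)(d,d)\rangle+\langle e^*,\nabla^2G(z_0)(d,d)\rangle\ge0$.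
   Context: $z_0$ is a locally weak Pareto solution of (MP2) if there is $\epsilon>0$ such that $I(z)-I(z_0)\notin-\mathrm{int}\,\mathbb{R}^m_+$ for every feasible $z=(x,u)$ with $\|x-x_0\|\le\epsilon$, $\|u-u_0\|\le\epsilon$. $T(D;z_0)$ is the contingent cone $\{h:\exists t_k\to0^+,\exists h_k\to h,\ z_0+t_kh_k\in D\}$. $\Lambda_2(z_0)$ is the set of $(\lambda,v^*,e^* )\in\mathbb{R}^m_+\times E_0^*\times E^*$ with $|\lambda|=1$, $\nabla_z\mathcal{L}_2(z_0,\lambda,v^*,e^* )=0$ and $e^*\in N(Q;G(z_0))=\{e^*:\langle e^*,e-G(z_0)\rangle\le0\ \forall e\in Q\}$, where $\mathcal{L}_2(z,\lambda,v^*,e^* )=\langle\lambda,I(z)\rangle+\langle v^*,F(z)\rangle+\langle e^*,G(z)\rangle$. $\mathcal{C}_2(z_0)$ is the closure in $Z$ of $\mathcal{C}_{02}(z_0)=\{d\in Z:\nabla I(z_0)d\in-\mathbb{R}^m_+,\ \nabla F(z_0)d=0,\ \nabla G(z_0)d\in\mathrm{cone}(Q-G(z_0))\}$, with $\mathrm{cone}(Q-G(z_0))=\{\mu(q-G(z_0)):q\in Q,\mu>0\}$. *)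

(* Defs.v *)
From HB Require Import structures.
From mathcomp Require Import all_boot all_order all_algebra.
From mathcomp Require Import all_classical all_reals all_analysis.
Set Implicit Arguments. Unset Strict Implicit. Unset Printing Implicit Defensive.
Import Order.TTheory GRing.Theory Num.Theory.
Import numFieldNormedType.Exports.
Local Open Scope classical_set_scope.
Local Open Scope ring_scope.

Section Defs.
Context {R : realType}.

Definition d2 {V W : normedModType R} (f : V -> W) (z h k : V) : W :=
  'd (fun y => 'd f y k) z h.

(* f is twice continuously Fréchet differentiable on the (open) set O:
   f is Fréchet differentiable on O, the map z |-> 'd f z (valued in the space
   of continuous linear maps, with operator norm) is Fréchet differentiable on
   O with derivative the bounded bilinear map d2 f z, and z |-> d2 f z is
   continuous on O for the bilinear operator norm. *)
Definition C2_on {V W : normedModType R} (O : set V) (f : V -> W) : Prop :=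
  [/\ forall z, O z -> differentiable f z,
      forall z k, O z -> differentiable (fun y => 'd f y k) z,
      forall z, O z -> exists C : R, forall h k,
          `|d2 f z h k| <= C * `|h| * `|k|,
      forall z, O z -> forall e : R, 0 < e -> exists2 del : R, 0 < del &
          forall h, `|h| < del -> forall k,
            `|'d f (z + h) k - 'd f z k - d2 f z h k| <= e * `|h| * `|k|
    & forall z, O z -> forall e : R, 0 < e -> exists2 del : R, 0 < del &
          forall z', O z' -> `|z' - z| < del -> forall h k,
            `|d2 f z' h k - d2 f z h k| <= e * `|h| * `|k| ].

Definition contingent_cone {V : normedModType R} (D : set V) (z0 : V) : set V :=
  [set h | exists (t : nat -> R) (hs : nat -> V),
     [/\ forall k, 0 < t k, t @ \oo --> (0 : R), hs @ \oo --> h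
       & forall k, D (z0 + t k *: hs k)]].

Definition orthant (m : nat) : set 'rV[R]_m := [set v | forall i, 0 <= v ord0 i].

Definition pair_rV (m : nat) (a b : 'rV[R]_m) : R := \sum_(i < m) a ord0 i * b ord0 i.

Definition dual_elem {V : normedModType R} (e : {linear V -> R^o}) : Prop :=
  continuous (e : V -> R).

Definition cone_of {V : normedModType R} (Q : set V) (a : V) : set V :=
  [set w | exists mu : R, exists2 q, Q q & 0 < mu /\ w = mu *: (q - a)].

Definition normal_cone {V : normedModType R} (Q : set V) (a : V)
  (e : {linear V -> R^o}) : Prop := forall q, Q q -> e (q - a) <= 0.

Definition neg_set {V : zmodType} (A : set V) : set V := [set - a | a in A].

End Defs.

(* Main.v *)
Require Import Defs.
From HB Require Import structures.
From mathcomp Require Import all_boot all_order all_algebra.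
From mathcomp Require Import all_classical all_reals all_analysis.
From mathcomp Require Import ring lra.
Set Implicit Arguments. Unset Strict Implicit. Unset Printing Implicit Defensive.
Import Order.TTheory GRing.Theory Num.Theory.
Import numFieldNormedType.Exports.
Local Open Scope classical_set_scope.
Local Open Scope ring_scope.

(* Write H = (F, G). By (A2) and (A3) the derivative H'(z0) maps onto E0 x E, so
   the open mapping theorem and Newton's iteration correct any approximate
   solution of H(z) = y with an error proportional to the residual. For d in
   C_02(z0), correcting the parabola z0 + t d + (t^2/2) w onto a curve of Q shows
   that no w satisfies I'w + I''(d,d) < 0, F'w + F''(d,d) = 0 and
   G'w + G''(d,d) in cone(Q - G(z0)); by Hahn-Banach this infeasibility yields a
   multiplier for d. Normalised by sum lambda_i = 1, these multipliers are
   bounded uniformly in d because H'(z0) has a bounded right inverse, which gives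
   the result on the closure C_2(z0). *)

(** * Hahn-Banach theorem *)

(** (A3) enters through the inclusion of the contingent cone in the kernel of F'(z0): a preimage
    given by (A3) adjusts G'w without disturbing F'w, so (A2) and (A3) together make H'(z0) onto.
    Surjectivity plays the part that an interior point of Q plays in other separation arguments: it
    makes the sublinear bound behind the separation finite everywhere, and it rules out lambda = 0.
    The detour through C_02(z0) is forced because cone(Q - G(z0)) need not be closed: only for a
    direction in the cone itself does convexity place a whole curve inside Q. The set of bounded
    normalised multipliers does not depend on d; only the sign of the Hessian term does. Its
    conditions, including sum lambda_i = 1, are linear equalities and inequalities in the
    multiplier, so they survive limits. The normalisation |lambda| = 1 is not linear and is reached
    by a final rescaling. *)

Definition is_cone (R : realType) (V : lmodType R) (C : set (R * V)) : Prop :=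
  (forall r s v w, C (r, v) -> C (s, w) -> C (r + s, v + w)) /\
  (forall t r v, 0 < t -> C (r, v) -> C (t * r, t *: v)).

Lemma linear_of (R : realType) (V W : lmodType R) (f : V -> W) :
  linear f -> exists g : {linear V -> W}, g =1 f.
Proof.
move=> lf.
pose g : {linear V -> W} := HB.pack f (GRing.isLinear.Build _ _ _ _ _ lf).
by exists g.
Qed.

(* The pairs [(r, v)] of [C] are the constraints [g v <= r]; a maximal
   consistent cone of constraints is the epigraph of a linear functional. *)
Lemma hahn_banach_cone (R : realType) (V : lmodType R) (C : set (R * V)) :
  is_cone C -> (forall v, exists r, C (r, v)) ->
  (forall r, C (r, 0) -> 0 <= r) ->
  exists g : {linear V -> R^o}, forall r v, C (r, v) -> g v <= r.
Proof.
move=> [CD CZ] Ctot C0.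
pose good (A : set (R * V)) :=
  [/\ A (0, 0), is_cone A & forall r, A (r, 0) -> 0 <= r].
(* A cone in the sense of [is_cone] is scaled by positive factors only and may miss the origin,
   which is adjoined here. *)
pose C1 := C `|` [set (0, 0)].
have goodC1 : good C1.
  split; first by right.
    split=> [r s v w [Cr|[-> ->]] [Cs|[-> ->]]|t r v t0 [Cr|[-> ->]]].
    - by left; exact: CD.
    - by rewrite !addr0; left.
    - by rewrite !add0r; left.
    - by rewrite !addr0; right.
    - by left; exact: CZ.
    - by rewrite mulr0 scaler0; right.
  by move=> r [/C0//|[->]].
(* Goodness is asked of the union of [A] with [C1], so that the empty chain, whose union is empty,
   is also admissible for Zorn. *)
have [A [gA maxA]] : exists A, good (A `|` C1) /\
    forall B, A `<` B -> ~ good (B `|` C1).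
  apply: (@Zorn_bigcup _ (fun A => good (A `|` C1))) => F FP Ftot.
  have [[X0 FX0]|F0] := pselect (exists X, F X); last first.
    suff -> : \bigcup_(X in F) X = set0 by rewrite set0U.
    by rewrite -subset0 => x [X FX _]; apply: F0; exists X.
  have up x : (\bigcup_(X in F) X `|` C1) x -> exists2 X, F X & (X `|` C1) x.
    by case=> [[X FX Xx]|C1x]; [exists X => //; left|exists X0 => //; right].
  have dn X x : F X -> (X `|` C1) x -> (\bigcup_(X in F) X `|` C1) x.
    by move=> FX [Xx|]; [left; exists X|right].
  split; first by right; right.
  - split=> [r s v w /up[X FX Xr] /up[Y FY Ys]|t r v t0 /up[X FX Xr]].
    + have [XY|YX] := Ftot _ _ FX FY.
      * have [_ [YD _] _] := FP _ FY; apply: (dn Y) => //; apply: YD => //.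
        by case: Xr => [/XY|]; [left|right].
      * have [_ [XD _] _] := FP _ FX; apply: (dn X) => //; apply: XD => //.
        by case: Ys => [/YX|]; [left|right].
    + have [_ [_ XZ] _] := FP _ FX; apply: (dn X) => //; exact: XZ.
  - by move=> r /up[X FX Xr]; have [_ _] := FP _ FX; exact.
pose M := A `|` C1; have [M0 [MD MZ] Mpos] : good M := gA.
(* Maximality as a membership test: the cone [B] generated by [M] and the new constraint is still
   consistent, so it adds nothing. *)
have maxM rho v : (forall r t, 0 <= t -> M (r, - (t *: v)) -> 0 <= r + t * rho) ->
    M (rho, v).
  move=> H; pose B := [set x | exists m t, [/\ M m, 0 <= t &
    x = (m.1 + t * rho, m.2 + t *: v)]].
  have MB : M `<=` B.
    move=> [r x] Mr; exists (r, x), 0; split => //=.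
    by rewrite mul0r scale0r !addr0.
  have BC1 : B `|` C1 = B by apply/setUidPl => x C1x; apply: MB; right.
  have Brho : B (rho, v).
    by exists (0, 0), 1; split => //=; rewrite mul1r scale1r !add0r.
  apply: contrapT => nM; apply: (maxA B).
    by split; [move=> x Ax; apply: MB; left|move=> /(_ _ Brho) ?; apply: nM; left].
  rewrite BC1; split; first exact: MB.
  - split.
    + move=> r s x y [[a1 a2] [t [Ma t0 [-> ->]]]] [[b1 b2] [u [Mb u0 [-> ->]]]].
      exists (a1 + b1, a2 + b2), (t + u); split; [exact: MD|exact: addr_ge0|] => /=.
      by rewrite mulrDl scalerDl !addrA; congr (_, _); rewrite -!addrA; congr (_ + _);
        rewrite addrCA.
    + move=> k r x k0 [[a1 a2] [t [Ma t0 [-> ->]]]].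
      exists (k * a1, k *: a2), (k * t); split; [exact: MZ|by rewrite mulr_ge0// ltW|] => /=.
      by rewrite mulrDr scalerDr mulrA scalerA.
  - move=> r [[a1 a2] [t [/= Ma t0 [-> /esym/eqP]]]].
    by rewrite addr_eq0 => /eqP a2E; apply: H => //; rewrite -a2E.
have Mup r s v : r <= s -> M (r, v) -> M (s, v).
  move=> rs Mr; rewrite -[s](subrK r) addrC -[v]addr0; apply: MD => //.
  apply: maxM => a t t0; rewrite scaler0 oppr0 => /Mpos a0.
  by rewrite addr_ge0// mulr_ge0// subr_ge0.
(* The maximal cone decides every comparison: it contains g v <= rho or the opposite constraint g v
   >= rho. *)
have dich rho v : ~ M (rho, v) -> M (- rho, - v).
  move=> nM; apply: contrapT => nM'; apply: nM; apply: maxM => r t t0 Mr.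
  rewrite leNgt; apply/negP => rt; apply: nM'.
  have {}t0 : 0 < t.
    rewrite lt_neqAle t0 andbT eq_sym; apply/eqP => t0'; move: rt Mr.
    by rewrite t0' mul0r addr0 scale0r oppr0 => r0 /Mpos; rewrite leNgt r0.
  apply: (Mup (t^-1 * r)).
    by rewrite ler_pdivrMl//; lra.
  have -> : - v = t^-1 *: - (t *: v) by rewrite scalerN scalerA mulVf ?gt_eqF// scale1r.
  by apply: MZ => //; rewrite invr_gt0.
pose S v := [set r | M (r, v)].
have Sn0 v : S v !=set0 by have [r Cr] := Ctot v; exists r; right; left.
have Slb v : has_lbound (S v).
  have [r Cr] := Sn0 (- v); exists (- r) => s Ms.
  by rewrite -subr_ge0 opprK; apply: Mpos; rewrite -(subrr v); exact: MD.
pose g v := inf (S v).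
have gle r v : M (r, v) -> g v <= r by move=> Mr; exact: ge_inf.
have geg x v : (forall r, M (r, v) -> x <= r) -> x <= g v.
  by move=> H; apply: lb_le_inf.
have gD v w : g (v + w) <= g v + g w.
  rewrite -lerBlDr; apply/geg => r Mr.
  rewrite lerBlDr [r + _]addrC -lerBlDr; apply/geg => s Ms.
  by rewrite lerBlDr [s + _]addrC; apply: gle; exact: MD.
have gZ t v : 0 < t -> g (t *: v) <= t * g v.
  move=> t0; rewrite -ler_pdivrMl//; apply/geg => r Mr.
  by rewrite ler_pdivrMl//; apply: gle; exact: MZ.
(* Up to here [g] is only sublinear. By [dich], every bound below [g v] fails and its opposite
   holds, which makes [g] odd and hence additive. *)
have gN v : g (- v) = - g v.
  apply/eqP; rewrite eq_le; apply/andP; split.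
    apply/ler_addgt0Pr => e e0.
    have nM : ~ M (g v - e, v) by move=> /gle; rewrite leNgt ltrBlDr ltrDl e0.
    by have /gle := dich _ _ nM; rewrite opprB addrC.
  rewrite lerNl -subr_ge0 opprK addrC.
  apply: le_trans (gD _ _); rewrite addNr; apply/geg => r; exact: Mpos.
have gD' v w : g (v + w) = g v + g w.
  apply/eqP; rewrite eq_le gD/= -[g (v + w)]opprK -gN opprD lerNr.
  by rewrite (le_trans (gD _ _))// !gN opprD.
have gZ' t v : 0 < t -> g (t *: v) = t * g v.
  move=> t0; apply/eqP; rewrite eq_le gZ//= -ler_pdivlMl//.
  rewrite -[in leLHS](scale1r v) -(mulVf (lt0r_neq0 t0)) -scalerA.
  by apply: gZ; rewrite invr_gt0.
have g0 : g 0 = 0 by have := gD' 0 0; rewrite addr0 => /eqP; lra.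
have glin : linear (g : V -> R^o).
  move=> t v w; rewrite gD'; congr (_ + _).
  have [t0|t0|->] := ltgtP t 0.
  - by rewrite -[t]opprK scaleNr gN gZ' ?oppr_gt0// scaleNr.
  - exact: gZ'.
  - by rewrite !scale0r g0.
have [h hE] := linear_of glin.
by exists h => r v Cr; rewrite hE; apply: gle; right; left.
Qed.

(* Weak* compactness is replaced by a second use of [hahn_banach_cone], with
   the support function of [L] as the sublinear bound. *)
Lemma functional_limit (R : realType) (V : lmodType R) (L : set {linear V -> R^o})
    (x : V) :
  (forall v, exists M : R, forall g, L g -> g v <= M) ->
  (forall e : R, 0 < e -> exists2 g, L g & - e <= g x) ->
  exists2 g : {linear V -> R^o},
    forall (r : R) v, (forall g', L g' -> g' v <= r) -> g v <= r & 0 <= g x.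
Proof.
move=> Lbd Lx.
(* The extra term in [t] forces the sign at [x]: with t = 1 the vector - x receives the constraint g
   (- x) <= 0. Consistency uses members of [L] whose value at [x] is at least - e / (t + 1). *)
have [|||g gP] := @hahn_banach_cone R V
    [set p | exists2 t : R, 0 <= t & forall g, L g -> g p.2 + t * g x <= p.1].
- split=> [r s v w [a a0 /= Ha] [b b0 /= Hb]|t r v t0 [a a0 /= Ha]].
    exists (a + b); first exact: addr_ge0.
    move=> g Lg /=; apply: le_trans (lerD (Ha _ Lg) (Hb _ Lg)).
    by rewrite linearD mulrDl addrACA.
  exists (t * a); first by rewrite mulr_ge0// ltW.
  move=> g Lg /=; apply: le_trans (ler_wpM2l (ltW t0) (Ha _ Lg)).
  by rewrite linearZ mulrDr mulrA.
- move=> v; have [M HM] := Lbd v; exists M, 0 => //= g Lg.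
  by rewrite mul0r addr0; exact: HM.
- move=> r [t t0 /= H]; apply/ler_addgt0Pr => e e0.
  have t10 : 0 < t + 1 by rewrite ltr_wpDl.
  have [g Lg gx] := Lx _ (divr_gt0 e0 t10).
  have := H _ Lg; rewrite linear0 add0r => le; rewrite -lerBlDr sub0r.
  apply: le_trans le; apply: le_trans (ler_wpM2l t0 gx).
  by rewrite mulrN lerN2 mulrCA ler_piMr ?(ltW e0)// ler_pdivrMr// mul1r lerDl.
exists g; first by move=> r v H; apply: gP; exists 0 => // h Lh; rewrite mul0r addr0; exact: H.
rewrite -oppr_le0 -linearN; apply: gP; exists 1 => //= h Lh.
by rewrite mul1r linearN addNr.
Qed.

(** Dominating by the infimum over s of |v + s y| - s |y| avoids defining a functional on the line
    of [y] first: s = 0 gives the norm bound, and s = 1 at v = - y gives the value at [y]. *)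
Lemma norming_functional (R : realType) (W : normedModType R) (y : W) :
  exists g : {linear W -> R^o}, g y = `|y| /\ forall x, `|g x| <= `|x|.
Proof.
have [|||g gP] := @hahn_banach_cone R W
    [set p | exists s : R, `|p.2 + s *: y| - s * `|y| <= p.1].
- split=> [r s v w [a /= Ha] [b /= Hb]|t r v t0 [a /= Ha]].
    exists (a + b) => /=; apply: le_trans (lerD Ha Hb).
    rewrite mulrDl opprD addrACA lerD2r scalerDl addrACA; exact: ler_normD.
  exists (t * a) => /=.
  by rewrite -scalerA -scalerDr normrZ gtr0_norm// -mulrA -mulrBr ler_pM2l.
- by move=> v; exists (`|v|), 0 => /=; rewrite scale0r mul0r addr0 subr0.
- move=> r [s /=]; rewrite add0r normrZ; apply: le_trans.
  by rewrite subr_ge0 ler_wpM2r// ler_norm.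
have gle x : g x <= `|x|.
  by apply: gP; exists 0 => /=; rewrite scale0r mul0r addr0 subr0.
exists g; split; last first.
  by move=> x; rewrite ler_norml gle andbT lerNl -linearN -(normrN x) gle.
apply/eqP; rewrite eq_le gle/= -lerN2 -linearN; apply: gP; exists 1 => /=.
by rewrite scale1r addNr normr0 mul1r sub0r.
Qed.

(** * Mean value inequality and second-order expansions *)

Lemma norm_le_linear_continuous (R : realType) (V W : normedModType R)
    (f : {linear V -> W}) (K : R) :
  (forall x, `|f x| <= K * `|x|) -> continuous f.
Proof.
move=> fK; apply/bounded_linear_continuous/bounded_funP => r.
exists (`|K| * r) => x xr; apply: le_trans (fK x) _.
by apply: (le_trans (ler_wpM2r _ (ler_norm K))) => //; rewrite ler_wpM2l.
Qed.

(** A norming functional of the increment reduces the claim to the scalar mean value theorem. *)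
Lemma mean_value_norm (R : realType) (W : normedModType R) (phi : R -> W) (M : R) :
  (forall s : R, 0 <= s <= 1 -> differentiable phi s) ->
  (forall s : R, 0 <= s <= 1 -> `|'d phi s 1| <= M) ->
  `|phi 1 - phi 0| <= M.
Proof.
move=> dphi phiM.
have [g [gE gle]] := norming_functional (phi 1 - phi 0).
have gc : continuous g.
  by apply: (@norm_le_linear_continuous _ _ _ _ 1) => x; rewrite mul1r.
have dg s : differentiable (g : W -> R^o) s by exact: linear_differentiable.
pose psi : R -> R^o := g \o phi.
have dpsi (s : R) : 0 <= s <= 1 -> differentiable psi s.
  by move=> s01; apply: differentiable_comp => //; exact: dphi.
have [||c c01] := @MVT_segment R psi (fun s => g ('d phi s 1)) 0 1 ler01.
- move=> s; rewrite in_itv/= => /andP[s0 s1].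
  have s01 : 0 <= s <= 1 by rewrite !ltW.
  have dps := dpsi _ s01.
  apply: DeriveDef; first exact/derivable1_diffP.
  by rewrite deriveE// diff_comp//=; [rewrite diff_lin|exact: dphi].
- apply: continuous_in_subspaceT => s; rewrite inE/= in_itv/= => s01.
  exact/differentiable_continuous/dpsi.
rewrite subr0 mulr1 /psi /= -linearB gE => ->.
by apply: le_trans (ler_norm _) _; apply: le_trans (gle _) _; apply: phiM; move: c01; rewrite in_itv.
Qed.

(** Mean value inequality for f (x + s k) - s A - (s^2 / 2) B. With B = 0 it serves first-order
    estimates, with B a second derivative it gives Taylor's formula. *)
Lemma segment_expansion (R : realType) (V W : normedModType R) (f : V -> W)
    (x k : V) (A B : W) (M : R) :
  (forall s : R, 0 <= s <= 1 -> differentiable f (x + s *: k)) ->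
  (forall s : R, 0 <= s <= 1 -> `|'d f (x + s *: k) k - A - s *: B| <= M) ->
  `|f (x + k) - f x - A - 2^-1 *: B| <= M.
Proof.
move=> df dfM.
pose aff (s : R) := x + s *: k.
have daff (s : R) : is_diff s aff (fun h => h *: k).
  have -> : aff = cst x + (fun s : R => s *: k) by [].
  by apply: is_diff_eq; rewrite add0r.
have dfaff (s : R) : 0 <= s <= 1 -> differentiable (f \o aff) s.
  by move=> s01; apply: differentiable_comp; [exact: ex_diff|exact: df].
pose sq (s : R) : R := s ^+ 2.
have dsq (s : R) : is_diff s sq (fun h => 2 * s * h).
  have -> : sq = (id : R -> R) ^+ 2 by apply/funext => t; rewrite /sq fctE.
  apply: is_diff_eq; apply/funext => h /=.
  by rewrite !fctE /= expr1.
pose phi := (f \o aff) - (fun s : R => s *: A) - (fun s : R => sq s *: (2^-1 *: B)).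
have d3 (s : R) : is_diff s (fun s : R => sq s *: (2^-1 *: B)) (fun h => (s * h) *: B).
  apply: DiffDef; first exact: differentiableZl.
  rewrite diffZl// diff_val; apply/funext => h.
  by rewrite scalerA; congr (_ *: _); field.
have -> : f (x + k) - f x - A - 2^-1 *: B = phi 1 - phi 0.
  rewrite /phi !fctE /= /aff /sq !scale1r !scale0r expr1n expr0n/= scale0r scale1r.
  by rewrite addr0 !subr0 [RHS]addrAC; congr (_ - _); rewrite addrAC.
have dphi1 (s : R) : 0 <= s <= 1 -> differentiable ((f \o aff) - (fun s : R => s *: A)) s.
  by move=> s01; apply: differentiableB; [exact: dfaff|exact: ex_diff].
apply: mean_value_norm => s s01.
  by apply: differentiableB; [exact: dphi1|exact: ex_diff].
rewrite diffB; [|exact: dphi1|exact: ex_diff].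
rewrite diffB; [|exact: dfaff|exact: ex_diff].
rewrite !fctE diff_comp; [|exact: ex_diff|exact: df].
by rewrite /= !diff_val mulr1 !scale1r; exact: dfM.
Qed.

Definition C2_at (R : realType) (V W : normedModType R) (f : V -> W) (z : V) : Prop :=
  [/\ exists2 r : R, 0 < r & forall h, `|h| < r -> differentiable f (z + h),
      forall k, differentiable (fun y => 'd f y k) z,
      exists2 B : R, 0 <= B & forall h k, `|d2 f z h k| <= B * `|h| * `|k|
    & forall e : R, 0 < e -> exists2 r : R, 0 < r & forall h, `|h| < r -> forall k,
        `|'d f (z + h) k - 'd f z k - d2 f z h k| <= e * `|h| * `|k| ].

Section second_order_expansion.
Context (R : realType) (V W : normedModType R) (f : V -> W) (z : V).
Hypothesis fC2 : C2_at f z.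

Lemma C2_at_diff : differentiable f z.
Proof. by have [[r r0 df] _ _ _] := fC2; rewrite -[z]addr0; apply: df; rewrite normr0. Qed.

Lemma d2Dl h h' k : d2 f z (h + h') k = d2 f z h k + d2 f z h' k.
Proof. exact: linearD. Qed.

Lemma d2Zl t h k : d2 f z (t *: h) k = t *: d2 f z h k.
Proof. exact: linearZ. Qed.

Lemma d2Dr h k k' : d2 f z h (k + k') = d2 f z h k + d2 f z h k'.
Proof.
have [_ dk _ _] := fC2; rewrite /d2.
have -> : (fun y => 'd f y (k + k')) = (fun y => 'd f y k) + (fun y => 'd f y k').
  by apply/funext => y; rewrite linearD.
by rewrite diffD.
Qed.

Lemma d2Zr t h k : d2 f z h (t *: k) = t *: d2 f z h k.
Proof.
have [_ dk _ _] := fC2; rewrite /d2.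
have -> : (fun y => 'd f y (t *: k)) = t *: (fun y => 'd f y k).
  by apply/funext => y; rewrite linearZ.
by rewrite diffZ.
Qed.

Lemma taylor2 (e : R) : 0 < e -> exists2 r : R, 0 < r & forall k, `|k| < r ->
  `|f (z + k) - f z - 'd f z k - 2^-1 *: d2 f z k k| <= e * `|k| ^+ 2.
Proof.
move=> e0; have [[r1 r10 df] _ _ /(_ _ e0)[r2 r20 rem]] := fC2.
exists (Num.min r1 r2); first by rewrite lt_min r10.
move=> k; rewrite lt_min => /andP[kr1 kr2].
have sk s : 0 <= s <= 1 -> `|s *: k| <= `|k|.
  by move=> /andP[s0 s1]; rewrite normrZ ger0_norm// ler_piMl.
apply: segment_expansion => s s01; first by apply: df; exact: le_lt_trans (sk _ s01) _.
rewrite -d2Zl; apply: le_trans (rem _ _ k) _; first exact: le_lt_trans (sk _ s01) _.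
by rewrite expr2 mulrA ler_wpM2r// ler_wpM2l ?sk// ltW.
Qed.

(** On a ball around [z], which contains the segment, the derivative differs from the one at [z] by
    at most (1 + B) times the distance to [z]; hence the radius e / (1 + B). Comparing two moving
    points with the derivative frozen at [z] is what Newton's method needs. *)
Lemma strictly_differentiable (e : R) : 0 < e -> exists2 r : R, 0 < r &
  forall x k, `|x - z| < r -> `|x + k - z| < r ->
    `|f (x + k) - f x - 'd f z k| <= e * `|k|.
Proof.
move=> e0; have [[r1 r10 df] _ [B B0 HB] /(_ _ ltr01)[r2 r20 rem]] := fC2.
have B10 : 0 < 1 + B by rewrite ltr_wpDr.
exists (Num.min (Num.min r1 r2) (e / (1 + B))).
  by rewrite !lt_min r10 r20 divr_gt0.
move=> x k xr xkr.
have seg s : 0 <= s <= 1 ->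
    `|x + s *: k - z| < Num.min (Num.min r1 r2) (e / (1 + B)).
  move=> /andP[s0 s1].
  have -> : x + s *: k - z = (1 - s) *: (x - z) + s *: (x + k - z).
    by rewrite addrAC [x + k - z]addrAC scalerBl scale1r [s *: (_ + k)]scalerDr addrA subrK.
  apply: le_lt_trans (ler_normD _ _) _; rewrite !normrZ !ger0_norm ?subr_ge0//.
  have [->|sn1] := eqVneq s 1; first by rewrite subrr mul0r add0r mul1r.
  set m := Num.min _ _; have -> : m = (1 - s) * m + s * m by ring.
  rewrite ltr_leD//.
    by rewrite ltr_pM2l// subr_gt0 lt_neqAle sn1.
  by rewrite ler_wpM2l// ltW.
have -> : f (x + k) - f x - 'd f z k = f (x + k) - f x - 'd f z k - 2^-1 *: 0.
  by rewrite scaler0 subr0.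
apply: segment_expansion => s /seg; rewrite !lt_min => /andP[/andP[l1 l2] l3].
  by rewrite -[x + _](subrK z) [_ + z]addrC; exact: df.
rewrite scaler0 subr0 -[x + _](subrK z) [_ + z]addrC.
move: (x + s *: k - z) l2 l3 => h hr2 he.
rewrite -['d f (z + h) k - _](subrK (d2 f z h k)).
apply: le_trans (ler_normD _ _) _; apply: le_trans (lerD (rem _ hr2 _) (HB _ _)) _.
rewrite -!mulrA -mulrDl mulrA ler_wpM2r// mulrC -ler_pdivlMr//; exact: ltW.
Qed.

(** [K] is a Lipschitz constant of the derivative at [z], fixed before [e] so that [e] may later be
    chosen in terms of it. The correction [rho] is of order t^2: its linear effect stays in the
    bound, its quadratic effect is of order t^3. *)
Lemma curve_expansion d w : exists2 K : R, 0 <= K & forall e : R, 0 < e ->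
  exists2 tau : R, 0 < tau & forall t rho, 0 < t -> t < tau -> `|rho| <= t ^+ 2 ->
  `|f (z + (t *: d + (t ^+ 2 / 2) *: w + rho)) - f z - t *: 'd f z d
    - (t ^+ 2 / 2) *: ('d f z w + d2 f z d d)| <= e * t ^+ 2 + K * `|rho|.
Proof.
have [_ _ [B B0 HB] _] := fC2.
have [K K0 HK] := linear_lipschitz (diff_continuous C2_at_diff).
exists K; first exact: ltW.
move=> e e0; pose N := `|d| + `|w| + 1.
have N0 : 0 < N by rewrite ltr_wpDl// addr_ge0.
have e20 : 0 < e / 2 / N ^+ 2 by rewrite !divr_gt0 ?exprn_gt0.
have [r r0 tay] := taylor2 e20.
(* For t < 1 the increment has norm at most N t, so t < r / N lets [taylor2] apply; the last bound
   makes the cross terms, at most B N^2 t^3, no larger than e / 2 * t^2. *)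
exists (Num.min (Num.min 1 (r / N)) (e / 2 / ((B + 1) * N ^+ 2))).
  by rewrite !lt_min ltr01/= !divr_gt0// mulr_gt0// ?exprn_gt0// ltr_wpDl.
move=> t rho t0; rewrite !lt_min => /andP[/andP[t1 tr] tB] rhot.
pose k' := (t ^+ 2 / 2) *: w + rho; pose k := t *: d + k'.
have k'N : `|k'| <= N * t ^+ 2.
  apply: le_trans (ler_normD _ _) _; rewrite normrZ ger0_norm; last first.
    by rewrite divr_ge0// sqr_ge0.
  have := mulr_ge0 (normr_ge0 d) (sqr_ge0 t).
  have := mulr_ge0 (normr_ge0 w) (sqr_ge0 t).
  rewrite /N !mulrDl mul1r; move: rhot (normr_ge0 w) => + _.
  by rewrite mulrAC [t ^+ 2 * _]mulrC; lra.
have tdN : `|t *: d| <= N * t.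
  rewrite normrZ gtr0_norm// mulrC ler_pM2r// /N; have := normr_ge0 w; lra.
have kN : `|k| <= N * t.
  apply: le_trans (ler_normD _ _) _; rewrite normrZ gtr0_norm//.
  apply: (@le_trans _ _ (t * `|d| + (`|w| + 1) * t ^+ 2)).
    rewrite lerD2l; apply: le_trans (ler_normD _ _) _.
    rewrite normrZ ger0_norm ?divr_ge0 ?sqr_ge0// mulrDl mul1r lerD// mulrC.
    by rewrite ler_wpM2l// ler_pdivrMr// ler_peMr ?sqr_ge0// ler1n.
  have -> : N * t = t * `|d| + (`|w| + 1) * t by rewrite /N; ring.
  rewrite lerD2l expr2 ler_wpM2l ?addr_ge0//.
  by rewrite ler_piMr// ltW.
have kr : `|k| < r by apply: le_lt_trans kN _; rewrite mulrC -ltr_pdivlMr.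
have -> : f (z + (t *: d + (t ^+ 2 / 2) *: w + rho)) - f z - t *: 'd f z d
    - (t ^+ 2 / 2) *: ('d f z w + d2 f z d d) =
    (f (z + k) - f z - 'd f z k - 2^-1 *: d2 f z k k) + 'd f z rho
    + 2^-1 *: (d2 f z k k' + d2 f z k' (t *: d)).
  have -> : d2 f z k k' + d2 f z k' (t *: d) = d2 f z k k - t ^+ 2 *: d2 f z d d.
    have -> : d2 f z k k = t ^+ 2 *: d2 f z d d + d2 f z k' (t *: d) + d2 f z k k'.
      by rewrite {2}/k d2Dr {1}/k d2Dl !d2Zr d2Zl scalerA.
    by rewrite [RHS]addrAC [t ^+ 2 *: _ + _]addrC addrK addrC.
  have -> : 'd f z k = t *: 'd f z d + (t ^+ 2 / 2) *: 'd f z w + 'd f z rho.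
    by rewrite /k /k' !linearD !linearZ /= addrA.
  rewrite scalerBr scalerA [2^-1 * _]mulrC scalerDr -[_ + rho]addrA -/k' -/k.
  have alg (a p q b s u : W) : a - p - (q + u) = a - (p + q + b) - s + b + (s - u).
    by rewrite !opprD !addrA; congr (_ - u); rewrite [_ - s + b]addrAC !subrK.
  exact: alg.
apply: le_trans (ler_normD _ _) _.
apply: le_trans (lerD (ler_normD _ _) (lexx _)) _.
have b1 := tay _ kr.
have b2 := HK rho.
have b3 : `|2^-1 *: (d2 f z k k' + d2 f z k' (t *: d))| <= B * N ^+ 2 * t ^+ 3.
  rewrite normrZ gtr0_norm// ler_pdivrMl//.
  have kk : `|k| * `|k'| <= N ^+ 2 * t ^+ 3.
    have -> : N ^+ 2 * t ^+ 3 = (N * t) * (N * t ^+ 2) by ring.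
    by rewrite ler_pM.
  have kd : `|k'| * `|t *: d| <= N ^+ 2 * t ^+ 3.
    have -> : N ^+ 2 * t ^+ 3 = (N * t ^+ 2) * (N * t) by ring.
    by rewrite ler_pM.
  apply: le_trans (ler_normD _ _) _; apply: le_trans (lerD (HB _ _) (HB _ _)) _.
  have := ler_wpM2l B0 kk; have := ler_wpM2l B0 kd; rewrite !mulrA; lra.
have b4 : e / 2 / N ^+ 2 * `|k| ^+ 2 <= e / 2 * t ^+ 2.
  rewrite -mulrA ler_pM2l ?divr_gt0// ler_pdivrMl ?exprn_gt0//.
  rewrite -exprMn; apply: lerXn2r kN; rewrite nnegrE//.
  by rewrite mulr_ge0// ltW.
have b5 : B * N ^+ 2 * t ^+ 3 <= e / 2 * t ^+ 2.
  rewrite [t ^+ 3]exprS mulrA ler_pM2r ?exprn_gt0//.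
  move: tB; rewrite ltr_pdivlMr; last by rewrite mulr_gt0 ?exprn_gt0// ltr_wpDl.
  have := ltW (mulr_gt0 t0 (exprn_gt0 2 N0)).
  have -> : t * ((B + 1) * N ^+ 2) = B * N ^+ 2 * t + t * N ^+ 2 by ring.
  lra.
lra.
Qed.

End second_order_expansion.

Lemma d2_diag_continuous (R : realType) (V W : normedModType R) (f : V -> W)
    (z d : V) (e : R) : C2_at f z -> 0 < e -> exists2 r : R, 0 < r &
  forall d', `|d - d'| < r -> `|d2 f z d d - d2 f z d' d'| <= e.
Proof.
move=> fC2 e0; have [_ _ [B B0 HB] _] := fC2.
have B10 : 0 < B + 1 by rewrite ltr_wpDl.
have N0 : 0 < `|d| + `|d| + 1 by rewrite ltr_wpDl// addr_ge0.
exists (Num.min 1 (e / (B + 1) / (`|d| + `|d| + 1))); first by rewrite lt_min ltr01 !divr_gt0.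
move=> d'; rewrite lt_min => /andP[d1 de].
have d'N : `|d'| <= `|d| + 1.
  rewrite -[d'](subKr d); apply: le_trans (ler_normB _ _) _.
  by rewrite lerD2l ltW.
have -> : d2 f z d d - d2 f z d' d' = d2 f z (d - d') d + d2 f z d' (d - d').
  have e1 : d2 f z d d = d2 f z (d - d') d + d2 f z d' d by rewrite -d2Dl subrK.
  have e2 : d2 f z d' d = d2 f z d' (d - d') + d2 f z d' d'.
    by rewrite -(d2Dr fC2) subrK.
  by rewrite e1 e2 addrA addrK.
apply: le_trans (ler_normD _ _) _; apply: le_trans (lerD (HB _ _) (HB _ _)) _.
apply: (@le_trans _ _ ((B + 1) * `|d - d'| * (`|d| + `|d| + 1))).
  rewrite -[B * `|d'| * _]mulrA [`|d'| * _]mulrC mulrA -mulrDr -addrA.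
  by rewrite ler_pM ?mulr_ge0 ?addr_ge0 ?lerD// ler_wpM2r// lerDl.
by rewrite -mulrA mulrC -!ler_pdivlMr// ltW.
Qed.

(** * Newton iteration and the open mapping theorem *)

Section prod_complete.
Context (R : realType) (V W : completeNormedModType R).

Let VW : normedModType R := (V * W)%type.

Let prod_cauchy_cvg (F : set_system VW) : ProperFilter F -> cauchy F -> cvg F.
Proof.
move=> FF /cauchyP Fc.
have c1 : cauchy ((fst : VW -> V) @ F).
  by apply/cauchy_exP => e e0; have [p Fp] := Fc _ e0; exists p.1;
    apply: (@filterS _ F _ _ _ _ Fp) => x px; case: (px : ball p.1 e x.1 /\ ball p.2 e x.2).
have c2 : cauchy ((snd : VW -> W) @ F).
  by apply/cauchy_exP => e e0; have [p Fp] := Fc _ e0; exists p.2;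
    apply: (@filterS _ F _ _ _ _ Fp) => x px; case: (px : ball p.1 e x.1 /\ ball p.2 e x.2).
have [a Ha] : exists a : V, (fst : VW -> V) @ F --> a.
  by exists (lim ((fst : VW -> V) @ F)); exact: cauchy_cvg c1.
have [b Hb] : exists b : W, (snd : VW -> W) @ F --> b.
  by exists (lim ((snd : VW -> W) @ F)); exact: cauchy_cvg c2.
apply: (@cvgP VW F (a, b)) => P [[A B] /= [/Ha FA /Hb FB] AB].
have FAB : F ((fst : VW -> V) @^-1` A `&` (snd : VW -> W) @^-1` B) by exact: filterI.
by apply: (@filterS _ F _ _ _ _ FAB) => x [Ax Bx]; apply: AB.
Qed.

(** Built over the existing normed-module class of the product, so that facts about [V * W] apply to
    it by conversion. *)
Definition prod_complete : completeNormedModType R :=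
  HB.pack (NormedModule.sort VW) (NormedModule.class VW)
    (Uniform_isComplete.Build VW prod_cauchy_cvg).

End prod_complete.

(* Newton's iteration with inexact linear solves: each step may leave half of
   the residual. *)
Lemma newton_iteration (R : realType) (Z : completeNormedModType R)
    (Y : normedModType R) (H : Z -> Y) (z0 : Z) (delta C : R) (y : Y) :
  0 <= C -> (forall z, `|z - z0| < delta -> {for z, continuous H}) ->
  (forall z, `|z - z0| < delta -> exists s, `|s| <= C * `|y - H z| /\
    (`|z + s - z0| < delta -> `|y - H (z + s)| <= 2^-1 * `|y - H z|)) ->
  forall z, `|z - z0| + 2 * C * `|y - H z| < delta ->
  exists2 z', H z' = y & `|z' - z| <= 2 * C * `|y - H z|.
Proof.
move=> C0 Hc Hstep z zdelta.
have /choice[st stP] : forall z, exists s, `|z - z0| < delta -> `|s| <= C * `|y - H z| /\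
    (`|z + s - z0| < delta -> `|y - H (z + s)| <= 2^-1 * `|y - H z|).
  (* Outside the ball the step is the default 0; the iterates never leave the ball. *)
  move=> x; have [/Hstep[s sP]|nx] := pselect (`|x - z0| < delta); first by exists s.
  by exists 0.
pose u n := iter n (fun x => x + st x) z.
set rho := `|y - H z| in zdelta *.
pose h n : R := 2^-1 ^+ n.
have h0 n : 0 < h n by rewrite exprn_gt0.
have hS n : h n.+1 = 2^-1 * h n by rewrite /h exprS.
have near_z0 x : `|x - z| <= 2 * C * rho -> `|x - z0| < delta.
  move=> xz; apply: le_lt_trans zdelta; rewrite -(subrKA z) addrC.
  by apply: le_trans (ler_normD _ _) _; rewrite lerD2l.
have rho0 : 0 <= rho by exact: normr_ge0.
have Crho : 0 <= C * rho by exact: mulr_ge0.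
(* The steps are at most C rho 2^-k, and their sum over k < n is 2 C rho (1 - 2^-n). *)
have inv n : `|u n - z| <= 2 * C * rho * (1 - h n) /\ `|y - H (u n)| <= rho * h n.
  elim: n => [|n [IH1 IH2]].
    by rewrite /u/= subrr normr0 /h expr0 subrr mulr0 mulr1.
  have un : `|u n - z0| < delta.
    by apply/near_z0/(le_trans IH1); have := mulr_ge0 Crho (ltW (h0 n)); lra.
  have [s1 s2] := stP _ un.
  have u1 : `|u n.+1 - z| <= 2 * C * rho * (1 - h n.+1).
    rewrite /u iterS -/(u n) addrAC; apply: le_trans (ler_normD _ _) _.
    have := le_trans s1 (ler_wpM2l C0 IH2); rewrite hS; lra.
  split=> //; apply: le_trans (s2 _) _; last by rewrite hS; lra.
  rewrite -[u n + _]/(u n.+1); apply/near_z0/(le_trans u1).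
  by have := mulr_ge0 Crho (ltW (h0 n.+1)); lra.
have un n : `|u n - z0| < delta.
  have [I1 _] := inv n.
  by apply/near_z0/(le_trans I1); have := mulr_ge0 Crho (ltW (h0 n)); lra.
have tail n k : `|u (n + k)%N - u n| <= 2 * C * rho * (h n - h (n + k)%N).
  elim: k => [|k IH]; first by rewrite addn0 !subrr normr0 mulr0.
  rewrite addnS /u iterS -/(u (n + k)%N) addrAC; apply: le_trans (ler_normD _ _) _.
  have [s1 _] := stP _ (un (n + k)%N).
  have [_ I2] := inv (n + k)%N.
  by have := le_trans s1 (ler_wpM2l C0 I2); rewrite hS; lra.
have hcvg : h @ \oo --> (0 : R).
  have -> : h = geometric 1 2^-1 by apply/funext => n; rewrite /h /geometric/= mul1r.
  by apply: cvg_geometric; rewrite gtr0_norm// invf_lt1// ltr1n.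
have [l ul] : exists l : Z, u @ \oo --> l.
  apply/cvg_ex; apply: (@cauchy_cvg Z (u @ \oo)); apply/cauchy_exP => e e0.
  have e'0 : 0 < e / (2 * C * rho + 1) by rewrite divr_gt0//; lra.
  have [n _ /(_ n (leqnn _))] := (cvgrPdist_lt _ _).1 hcvg _ e'0.
  rewrite /= sub0r normrN gtr0_norm// ltr_pdivlMr; last lra.
  move=> hn; rewrite /fmapE -ball_normE; exists (u n), n => // k nk /=.
  rewrite distrC -(subnKC nk); apply: le_lt_trans (tail _ _) _.
  have := mulr_ge0 Crho (ltW (h0 (n + (k - n))%N)); have := h0 n; lra.
have lz : `|l - z| <= 2 * C * rho.
  apply/ler_addgt0Pr => e e0.
  have [n _ /(_ n (leqnn _)) /= ln] := (cvgrPdist_lt _ _).1 ul _ e0.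
  rewrite -(subrKA (u n)) addrC; apply: le_trans (ler_normD _ _) _.
  apply: lerD (ltW ln); have [I1 _] := inv n; apply: le_trans I1 _.
  by have := mulr_ge0 Crho (ltW (h0 n)); lra.
exists l => //.
have Hul : H \o u @ \oo --> H l by apply: continuous_cvg => //; exact/Hc/near_z0.
have yul : H \o u @ \oo --> y.
  apply/cvgrPdist_lt => e e0.
  have e'0 : 0 < e / (rho + 1) by rewrite divr_gt0// ltr_wpDl.
  near=> n; have [_ I2] := inv n; apply: le_lt_trans I2 _.
  have : `|0 - h n| < e / (rho + 1) by near: n; exact: (cvgrPdist_lt _ _).1 hcvg _ e'0.
  rewrite sub0r normrN gtr0_norm// ltr_pdivlMr ?ltr_wpDl//.
  by have := h0 n; lra.
exact: (cvg_unique _ Hul yul).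
Unshelve. all: by end_near. Qed.

(** Baire's theorem yields only approximate preimages; once these leave at most half of the
    residual, [newton_iteration] applied to [T] itself makes them exact. *)
Lemma open_mapping (R : realType) (V W : completeNormedModType R)
    (T : {linear V -> W}) :
  continuous T -> (forall y, exists x, T x = y) ->
  exists2 C : R, 0 < C & forall y, exists2 x, T x = y & `|x| <= C * `|y|.
Proof.
move=> Tc Tsurj.
pose F (n : nat) := ~` closure (T @` [set x | `|x| <= n%:R]).
have [n [D [y0 [oD Dy0 DF]]]] : exists n D y0, [/\ open D, D y0 & D `&` F n = set0].
  apply: contrapT => nex.
  have : dense (\bigcap_i F i).
    apply: Baire => n; split; first exact/closed_openC/closed_closure.
    move=> D [y0 Dy0] oD; apply/set0P/negP => /eqP DF; apply: nex.
    by exists n, D, y0.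
  move=> /(_ setT) []; [by exists point|exact: openT|].
  move=> y [_ Fy]; have [x xy] := Tsurj y.
  apply: (Fy (Num.truncn `|x|).+1 Logic.I); apply: subset_closure; exists x => //=.
  by rewrite ltW// truncnS_gt.
have /nbhs_ballP[r /= r0 rD] : nbhs y0 D by apply: open_nbhs_nbhs.
have dens v e : `|v| < r -> 0 < e -> exists2 x, `|x| <= n%:R & `|T x - (y0 + v)| < e.
  move=> vr e0.
  have Dv : D (y0 + v).
    by apply: rD; rewrite -ball_normE /= opprD addNKr normrN.
  have : closure (T @` [set x | `|x| <= n%:R]) (y0 + v).
    apply: contrapT => nc; have : (D `&` F n) (y0 + v) by [].
    by rewrite DF.
  move=> /(_ _ (nbhsx_ballx _ _ e0)) [_ [[x xn <-]]].
  by rewrite -ball_normE /= distrC => xe; exists x.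
(* A target is scaled to norm r / 2 and solved by a difference of two points of norm at most n,
   hence 2 n / (r / 2). Their errors r / 8 add up to r / 4, half of the scaled target. *)
pose C := 4 * n%:R / r.
have C0 : 0 <= C by rewrite divr_ge0 ?mulr_ge0// ltW.
have approx y : exists s, `|s| <= C * `|y| /\ `|y - T s| <= 2^-1 * `|y|.
  have [->|y_neq0] := eqVneq y 0.
    by exists 0; rewrite linear0 subr0 !normr0 !mulr0.
  have y0' : 0 < `|y| by rewrite normr_gt0.
  pose c := r / 2 / `|y|; have c0 : 0 < c by rewrite !divr_gt0.
  have cy : `|c *: y| = r / 2 by rewrite normrZ gtr0_norm// divfK ?gt_eqF.
  have r80 : 0 < r / 8 by rewrite divr_gt0.
  have [|x1 x1n x1e] := dens (c *: y) _ _ r80; first by rewrite cy; lra.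
  have [|x2 x2n x2e] := dens 0 _ _ r80; first by rewrite normr0.
  exists (c^-1 *: (x1 - x2)); split.
    rewrite normrZ gtr0_norm ?invr_gt0// -ler_pdivlMl ?invr_gt0// invrK.
    apply: le_trans (ler_normB _ _) _.
    suff -> : c * (C * `|y|) = 2 * n%:R by lra.
    by rewrite /c /C; field; rewrite !gt_eqF.
  rewrite linearZ /= -(ler_pM2l c0) -[X in X * _ <= _](gtr0_norm c0) -normrZ.
  rewrite scalerBr scalerA mulfV ?gt_eqF// scale1r linearB.
  have -> : c * (2^-1 * `|y|) = r / 4 by rewrite /c; field; rewrite gt_eqF.
  have -> : c *: y - (T x1 - T x2) = (T x2 - (y0 + 0)) - (T x1 - (y0 + c *: y)).
    by rewrite addr0 !opprB !addrA subrK [T x2 + _]addrC.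
  apply: le_trans (ler_normB _ _) _; lra.
(* The 1 keeps the constant positive when n = 0. *)
exists (2 * C + 1); first by rewrite ltr_wpDl// mulr_ge0.
move=> y.
have [|||x Tx xle] :=
  @newton_iteration R V W T 0 (2 * C * `|y| + 1) C y C0 _ _ 0 _.
- by move=> z _; exact: Tc.
- move=> z _; have [s [sC sy]] := approx (y - T z); exists s; split=> // _.
  by rewrite linearD opprD addrA.
- by rewrite (linear0 T) !subr0 normr0 add0r ltrDl.
exists x => //; move: xle (normr_ge0 y); rewrite (linear0 T) !subr0; lra.
Qed.

Section correction.
Context (R : realType) (Z : completeNormedModType R) (E0 E : normedModType R).
Context (F : Z -> E0) (G : Z -> E) (z0 : Z) (C : R).
Hypotheses (FC2 : C2_at F z0) (GC2 : C2_at G z0) (C0 : 0 < C).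
Hypothesis onto : forall x y, exists2 w, ('d F z0 w = x) /\ ('d G z0 w = y) &
  `|w| <= C * Num.max `|x| `|y|.

(** Each Newton step solves the linear equation with the derivative frozen at [z0]. Strict
    differentiability with constant (2 C)^-1 leaves a residual of at most (2 C)^-1 |s|, half of the
    previous one. *)
Lemma correction : exists2 r : R, 0 < r & forall z x y,
  `|z - z0| + 2 * C * Num.max `|x - F z| `|y - G z| < r ->
  exists2 z', F z' = x /\ G z' = y & `|z' - z| <= 2 * C * Num.max `|x - F z| `|y - G z|.
Proof.
have e0 : 0 < (2 * C)^-1 by rewrite invr_gt0 mulr_gt0.
have [[rF rF0 dF] _ _ _] := FC2; have [[rG rG0 dG] _ _ _] := GC2.
have [r1 r10 sF] := strictly_differentiable FC2 e0.
have [r2 r20 sG] := strictly_differentiable GC2 e0.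
pose r := Num.min (Num.min rF rG) (Num.min r1 r2).
exists r; first by rewrite !lt_min rF0 rG0 r10 r20.
move=> z x y zr.
pose H (z : Z) : (E0 * E)%type := (F z, G z).
have HE t : `|(x, y) - H t| = Num.max `|x - F t| `|y - G t| by [].
have [|||z' Hz' z'z] := @newton_iteration R Z (E0 * E)%type H z0 r C (x, y) (ltW C0) _ _ z _.
- move=> t; rewrite !lt_min => /andP[/andP[tF tG] _].
  apply/differentiable_continuous/differentiable_pair.
    by rewrite -[t](subrK z0) addrC; exact: dF.
  by rewrite -[t](subrK z0) addrC; exact: dG.
- move=> t tr; have [s [sF' sG'] sle] := onto (x - F t) (y - G t).
  exists s; split; first exact: sle.
  move: tr; rewrite !lt_min => /andP[_ /andP[t1 t2]] /andP[_ /andP[ts1 ts2]].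
  have := sF _ _ t1 ts1; have := sG _ _ t2 ts2; rewrite sF' sG' !opprB.
  have cs : (2 * C)^-1 * `|s| <= 2^-1 * `|(x, y) - H t|.
    by rewrite invfM -mulrA ler_pM2l ?invr_gt0// ler_pdivrMl.
  move=> /le_trans /(_ cs) b2 /le_trans /(_ cs) b1.
  rewrite HE ge_max; apply/andP; split.
    by apply: le_trans b1; rewrite addrA subrK distrC.
  by apply: le_trans b2; rewrite addrA subrK distrC.
- by rewrite HE.
- by exists z'; [case: Hz'|exact: z'z].
Qed.

End correction.

(** * Multipliers *)

Lemma convex_setP (R : realType) (V : normedModType R) (Q : set V) (x y : V) (t : R) :
  @convex_set R V Q -> Q x -> Q y -> 0 <= t <= 1 -> Q (t *: x + (1 - t) *: y).
Proof.
move=> Qc Qx Qy /andP[t0 t1].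
have := Qc x y (Itv01 t0 t1); rewrite !inE => /(_ Qx Qy).
by [].
Qed.

Section cone_of_convex.
Context (R : realType) (V : normedModType R) (Q : set V) (a : V).
Hypotheses (Qc : @convex_set R V Q) (Qa : Q a).

Lemma cone_of0 : cone_of Q a 0.
Proof. by exists 1, a => //; rewrite subrr scaler0. Qed.

Lemma cone_ofZ t p : 0 < t -> cone_of Q a p -> cone_of Q a (t *: p).
Proof.
move=> t0 [mu [q Qq [mu0 ->]]]; exists (t * mu), q => //.
by rewrite scalerA mulr_gt0.
Qed.

Lemma cone_ofD p p' : cone_of Q a p -> cone_of Q a p' -> cone_of Q a (p + p').
Proof.
move=> [mu [q Qq [mu0 ->]]] [nu [q' Qq' [nu0 ->]]].
have s0 : 0 < mu + nu by rewrite addr_gt0.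
exists (mu + nu), (mu / (mu + nu) *: q + (1 - mu / (mu + nu)) *: q').
  apply: convex_setP => //; rewrite divr_ge0 ?(ltW mu0) ?(ltW s0)//=.
  by rewrite ler_pdivrMr// mul1r lerDl ltW.
have c1 : (mu + nu) * (mu / (mu + nu)) = mu by field; rewrite gt_eqF.
have c2 : (mu + nu) * (1 - mu / (mu + nu)) = nu by field; rewrite gt_eqF.
split => //; rewrite [RHS]scalerBr [(mu + nu) *: (_ + _)]scalerDr !scalerA c1 c2.
by rewrite !scalerBr scalerDl opprD addrACA.
Qed.

Lemma cone_of_near p : cone_of Q a p ->
  exists2 tau : R, 0 < tau & forall t, 0 <= t <= tau -> Q (a + t *: p).
Proof.
move=> [mu [q Qq [mu0 ->]]]; exists mu^-1; first by rewrite invr_gt0.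
move=> t /andP[t0 tmu].
have -> : a + t *: (mu *: (q - a)) = (t * mu) *: q + (1 - t * mu) *: a.
  by rewrite scalerA scalerBr scalerBl scale1r addrCA.
apply: convex_setP => //; rewrite mulr_ge0 ?(ltW mu0)//=.
by rewrite -ler_pdivlMr// mul1r.
Qed.

(** The point is the midpoint of a + 2 t p and a + t^2 p', both of which lie in [Q] for small t. *)
Lemma cone_of_curve p p' : cone_of Q a p -> cone_of Q a p' ->
  exists2 tau : R, 0 < tau & forall t, 0 < t -> t < tau ->
    Q (a + t *: p + (t ^+ 2 / 2) *: p').
Proof.
move=> /cone_of_near[s s0 Hs] /cone_of_near[s' s'0 Hs'].
exists (Num.min 1 (Num.min (s / 2) s')); first by rewrite !lt_min ltr01 s'0 divr_gt0.
move=> t t0; rewrite !lt_min => /andP[t1 /andP[ts ts']].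
have -> : a + t *: p + (t ^+ 2 / 2) *: p' =
    2^-1 *: (a + (2 * t) *: p) + (1 - 2^-1) *: (a + t ^+ 2 *: p').
  have -> : (1 : R) - 2^-1 = 2^-1 by field.
  rewrite !scalerDr addrACA -scalerDl !scalerA mulKf//.
  have -> : (2^-1 : R) + 2^-1 = 1 by field.
  by rewrite scale1r addrA [2^-1 * _]mulrC.
apply: convex_setP => //; last by rewrite invr_ge0 ler0n/= invf_le1 ?ler1n.
- by apply: Hs; rewrite mulr_ge0 ?(ltW t0)//= mulrC -ler_pdivlMr// ltW.
- apply: Hs'; rewrite sqr_ge0/=; apply: le_trans (ltW ts').
  by rewrite expr2 ler_piMl// ltW.
Qed.

End cone_of_convex.

(** Used to extract a sign condition on a multiplier from an inequality containing an arbitrary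
    positive multiple. *)
Lemma affine_ge0 (R : realFieldType) (A B : R) :
  (forall t, 0 < t -> 0 <= A + t * B) -> 0 <= B.
Proof.
move=> H; rewrite leNgt; apply/negP => B0.
have t0 : 0 < (`|A| + 1) / - B by rewrite divr_gt0 ?oppr_gt0// ltr_wpDl.
have := H _ t0; have -> : (`|A| + 1) / - B * B = - (`|A| + 1) by field; rewrite lt_eqF.
by have := ler_norm A; lra.
Qed.

Lemma ler_coord_norm (R : realFieldType) m (x : 'rV[R]_m) i : `|x ord0 i| <= `|x|.
Proof.
by rewrite [leRHS]mx_normrE; exact: (le_bigmax _ (fun ij => `|x ij.1 ij.2|) (ord0, i)).
Qed.

(** The second-order term lowers the value by at least k / 2 * u, more than the error k / 4 * u. *)
Lemma descent_bound (R : realFieldType) (a a0 x t u v k : R) :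
  0 < u -> 0 <= t -> 0 < k -> x <= 0 -> v <= - k ->
  a - a0 - t * x - u / 2 * v <= k / 4 * u -> a < a0.
Proof.
move=> u0 t0 k0 x0 vk; have := mulr_gt0 u0 k0.
by have := ler_wpM2l (ltW u0) vk; have := ler_wpM2l t0 x0; lra.
Qed.

Section multipliers.
Context (R : realType) (Z : completeNormedModType R) (E0 E : normedModType R).
Context (m : nat) (Q : set E) (I : Z -> 'rV[R]_m) (F : Z -> E0) (G : Z -> E).
Context (z0 : Z) (C : R).
Hypotheses (Qc : @convex_set R E Q) (F0 : F z0 = 0) (QG : Q (G z0)).
Hypotheses (IC2 : C2_at I z0) (FC2 : C2_at F z0) (GC2 : C2_at G z0) (C0 : 0 < C).
Hypothesis onto : forall x y, exists2 w, ('d F z0 w = x) /\ ('d G z0 w = y) &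
  `|w| <= C * Num.max `|x| `|y|.
Hypothesis weak_pareto : exists2 eps : R, 0 < eps & forall z, F z = 0 -> Q (G z) ->
  `|z - z0| < eps -> ~ forall i, I z ord0 i < I z0 ord0 i.

Let K := cone_of Q (G z0).

Definition critical (d : Z) : Prop :=
  [/\ forall i, 'd I z0 d ord0 i <= 0, 'd F z0 d = 0 & K ('d G z0 d)].

Lemma no_descent d w : critical d ->
  'd F z0 w + d2 F z0 d d = 0 -> K ('d G z0 w + d2 G z0 d d) ->
  ~ forall i, ('d I z0 w + d2 I z0 d d) ord0 i < 0.
Proof.
move=> [Id Fd Gd] Fw Gw Iw.
set b := 'd I z0 w + d2 I z0 d d in Iw.
have [kap kap0 bkap] : exists2 kap : R, 0 < kap & forall i, b ord0 i <= - kap.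
  (* Uniform slack over the coordinates; the default 1 keeps it positive when m = 0. *)
  exists (\big[Num.min/1]_i - b ord0 i).
    by apply: lt_bigmin => // i _; rewrite oppr_gt0.
  by move=> i; rewrite lerNr; exact: bigmin_le.
have [M1 M10 cI] := curve_expansion IC2 d w.
have [M2 M20 cF] := curve_expansion FC2 d w.
have [M3 M30 cG] := curve_expansion GC2 d w.
have [r r0 corr] := correction FC2 GC2 C0 onto.
have [eps eps0 wp] := weak_pareto.
have [tau0 tau00 Qy] := cone_of_curve Qc QG Gd Gw.
pose c := 2 * C; have c0 : 0 < c by rewrite mulr_gt0.
(* The first bound keeps the expansion error of [I], including the effect of the correction, below
   kap / 4 * t^2. The second keeps the correction, at most c e t^2, below t^2 as [curve_expansion]
   demands. *)
pose e := Num.min (kap / 4 / (1 + M1 * c)) c^-1.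
have Mc : 0 < 1 + M1 * c by rewrite ltr_pwDl// mulr_ge0// ltW.
have e0 : 0 < e by rewrite lt_min !divr_gt0 ?invr_gt0.
have [tau1 tau10 {}cI] := cI _ e0.
have [tau2 tau20 {}cF] := cF _ e0.
have [tau3 tau30 {}cG] := cG _ e0.
pose N := `|d| + `|w| + 1.
have N0 : 0 < N by rewrite ltr_wpDl// addr_ge0.
(* The parabola is within t N of [z0] and the correction within t^2 <= t, so t (N + 1) has to stay
   below both [r] and [eps]. *)
pose tau := Num.min (Num.min (Num.min tau0 tau1) (Num.min tau2 tau3))
  (Num.min 1 (Num.min (r / (N + 1)) (eps / (N + 1)))).
have tau_gt0 : 0 < tau.
  have N10 : 0 < N + 1 by rewrite addr_gt0.
  by rewrite !lt_min tau00 tau10 tau20 tau30 ltr01 !divr_gt0.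
have [t t0] : exists2 t, 0 < t & t < tau.
  by exists (tau / 2); rewrite ?divr_gt0// ltr_pdivrMr// ltr_pMr// ltr1n.
rewrite !lt_min => /andP[/andP[/andP[t_0 t_1] /andP[t_2 t_3]]].
move=> /andP[t1 /andP[tr te]].
have {}tr : t * (N + 1) < r by rewrite -ltr_pdivlMr// addr_gt0.
have {}te : t * (N + 1) < eps by rewrite -ltr_pdivlMr// addr_gt0.
have tt : t ^+ 2 <= t by rewrite expr2 ler_piMl// ltW.
pose p := z0 + (t *: d + (t ^+ 2 / 2) *: w + 0).
have z00 : `|0 : Z| <= t ^+ 2 by rewrite normr0 sqr_ge0.
pose y := G z0 + t *: 'd G z0 d + (t ^+ 2 / 2) *: ('d G z0 w + d2 G z0 d d).
have pz0 : `|p - z0| <= t * N.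
  rewrite /p addr0 addrAC subrr add0r; apply: le_trans (ler_normD _ _) _.
  rewrite !normrZ !ger0_norm ?divr_ge0 ?sqr_ge0 ?(ltW t0)//.
  rewrite /N 2!mulrDr -addrA lerD2l.
  apply: ler_wpDr; first by rewrite mulr1 ltW.
  by rewrite ler_wpM2r//; lra.
have bF : `|0 - F p| <= e * t ^+ 2.
  have := cF _ _ t0 t_2 z00; rewrite -/p normr0 mulr0 addr0 Fd Fw F0 !scaler0 !subr0.
  by rewrite sub0r normrN.
have bG : `|y - G p| <= e * t ^+ 2.
  have alg (a g u v : E) : g + u + v - a = - (a - g - u - v).
    by rewrite -[LHS]opprB !opprD !addrA.
  rewrite /y alg normrN; have := cG _ _ t0 t_3 z00.
  by rewrite -/p normr0 mulr0 addr0.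
have bmax : c * Num.max `|0 - F p| `|y - G p| <= t ^+ 2.
  rewrite mulrC -ler_pdivlMr// ge_max.
  have ec : e * t ^+ 2 <= t ^+ 2 / c.
    by rewrite mulrC ler_wpM2l ?sqr_ge0// ge_min lexx orbT.
  by rewrite (le_trans bF ec) (le_trans bG ec).
have [|z [Fz Gz] zp] := corr p 0 y.
  apply: le_lt_trans tr; rewrite mulrDr mulr1; apply: lerD => //.
  exact: le_trans tt.
have rho : `|z - p| <= t ^+ 2 by exact: le_trans zp bmax.
have rhoe : `|z - p| <= c * (e * t ^+ 2).
  by apply: le_trans zp _; rewrite ler_pM2l// ge_max bF.
apply: (wp z) => //.
- by rewrite Gz; exact: Qy.
- apply: le_lt_trans te; rewrite -(subrKA p) addrC mulrDr mulr1.
  apply: le_trans (ler_normD _ _) _; rewrite lerD//; exact: le_trans rho tt.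
- move=> i.
  have := cI _ _ t0 t_1 rho.
  have -> : z0 + (t *: d + (t ^+ 2 / 2) *: w + (z - p)) = z.
    by rewrite /p addr0 addrA addrC subrK.
  rewrite -/b => bI.
  have bi : `|(I z - I z0 - t *: 'd I z0 d - (t ^+ 2 / 2) *: b) ord0 i| <= kap / 4 * t ^+ 2.
    apply: le_trans (ler_coord_norm _ _) _.
    apply: le_trans bI _.
    have : e <= kap / 4 / (1 + M1 * c) by rewrite ge_min lexx.
    rewrite ler_pdivlMr// => ek.
    have := ler_wpM2r (sqr_ge0 t) ek; have := ler_wpM2l M10 rhoe; lra.
  clearbody b; move: bi; rewrite !mxE => /ler_normlP[_].
  exact: descent_bound (exprn_gt0 2 t0) (ltW t0) kap0 (Id i) (bkap i).
Qed.

Let Y := ('rV[R]_m * (E0 * E))%type.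

Let hess (d : Z) : Y := (d2 I z0 d d, (d2 F z0 d d, d2 G z0 d d)).

Let jac (w : Z) : Y := ('d I z0 w, ('d F z0 w, 'd G z0 w)).

(** One functional on the product encodes the triple: g (a, (x, y)) is the sum of the pairings with
    lambda, v* and e*. The second clause says that the coordinates of lambda sum to 1. *)
Definition multiplier (M : R) (g : {linear Y -> R^o}) : Prop :=
  [/\ forall a, orthant a -> 0 <= g (a, 0), g (const_mx 1, 0) = 1,
      forall w, g (jac w) = 0, forall q, Q q -> g (0, (0, q - G z0)) <= 0
    & forall y, `|g (0, y)| <= M * `|y| ].

(** In the max norm both [a] and its opposite lie below |a| times the all-ones vector, and a
    positive functional preserves this order. *)
Lemma functional_le_norm (g : {linear Y -> R^o}) a :
  (forall a, orthant a -> 0 <= g (a, 0)) -> g (const_mx 1, 0) = 1 ->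
  `|g (a, 0)| <= `|a|.
Proof.
move=> gpos g1.
have gc : g (`|a| *: (const_mx 1 : 'rV_m), 0) = `|a|.
  have -> : (`|a| *: (const_mx 1 : 'rV_m), 0) = `|a| *: (const_mx 1, 0) :> Y.
    by congr (_, _); rewrite /= scaler0.
  by rewrite linearZ /= g1; exact: mulr1.
have le b : `|b| <= `|a| -> g (b, 0) <= `|a|.
  move=> ba; rewrite -subr_ge0 -gc -linearB.
  have -> : (`|a| *: const_mx 1, 0) - (b, 0) = (`|a| *: const_mx 1 - b, 0) :> Y.
    by congr (_, _); rewrite /= subr0.
  apply: gpos => i; rewrite !mxE mulr1 subr_ge0.
  exact: le_trans (ler_norm _) (le_trans (ler_coord_norm _ _) ba).
rewrite ler_norml le// andbT lerNl -linearN.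
have -> : - (a, 0) = (- a, 0) :> Y by congr (_, _); rewrite /= oppr0.
by apply: le; rewrite normrN.
Qed.

Lemma multiplier_bound M g a y : multiplier M g -> `|g (a, y)| <= `|a| + M * `|y|.
Proof.
move=> [gpos g1 _ _ gM].
have -> : (a, y) = (a, 0) + (0, y) :> Y by congr (_, _); rewrite ?addr0 ?add0r.
rewrite linearD; apply: le_trans (ler_normD _ _) _; apply: lerD (gM _).
exact: functional_le_norm.
Qed.

Lemma exists_multiplier : exists M : R, forall d, critical d ->
  exists2 g, multiplier M g & 0 <= g (hess d).
Proof.
have [k k0 kI] := linear_lipschitz (diff_continuous (C2_at_diff IC2)).
(* The bound is chosen before [d]: solving H'(z0) w = y turns g (0, y) into - g (I'w, 0), which is
   at most k |w| <= k C |y|. *)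
exists (k * C) => d dcrit.
(* The infimum of the admissible [u.1] is the least possible largest coordinate of I'w + s I''(d,d)
   - a under the perturbed constraints. The factor s > 0 homogenises the system; at the origin,
   dividing by s contradicts [no_descent] if r < 0. *)
pose X : set (R * Y) := [set u | exists w s p, [/\ 0 < s /\ K p,
  u.2.2.1 = 'd F z0 w + s *: d2 F z0 d d,
  u.2.2.2 = 'd G z0 w + s *: d2 G z0 d d - p &
  forall i, ('d I z0 w + s *: d2 I z0 d d - u.2.1) ord0 i <= u.1]].
have [|||h hX] := @hahn_banach_cone R Y X.
- split.
  + move=> r1 r2 [a1 [x1 y1]] [a2 [x2 y2]] [w1 [s1 [p1 [[s10 Kp1] /= -> -> H1]]]].
    move=> [w2 [s2 [p2 [[s20 Kp2] /= -> -> H2]]]].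
    exists (w1 + w2), (s1 + s2), (p1 + p2); split => /=.
    * by split; [exact: addr_gt0|exact: cone_ofD].
    * by rewrite linearD scalerDl addrACA.
    * by rewrite linearD scalerDl opprD addrACA [X in X + _ = _]addrACA.
    * move=> i; apply: le_trans (lerD (H1 i) (H2 i)).
      by rewrite linearD scalerDl opprD !mxE; rewrite le_eqVlt; apply/orP; left; apply/eqP; ring.
  + move=> t r [a [x y]] t0 [w [s [p [[s0 Kp] /= -> -> H]]]].
    exists (t *: w), (t * s), (t *: p); split => /=.
    * by split; [exact: mulr_gt0|exact: cone_ofZ].
    * by rewrite linearZ -scalerA -scalerDr.
    * by rewrite linearZ -scalerA -scalerDr -scalerBr.
    * move=> i; apply: le_trans (ler_wpM2l (ltW t0) (H i)).
      by rewrite linearZ -scalerA -scalerDr -scalerBr mxE.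
- move=> [a [x y]].
  have [w [Fw Gw] _] := onto (x - d2 F z0 d d) (y - d2 G z0 d d).
  exists `|'d I z0 w + 1 *: d2 I z0 d d - a|, w, 1, 0; split => //=.
  + by split=> //; exact: cone_of0.
  + by rewrite scale1r Fw subrK.
  + by rewrite scale1r Gw subrK subr0.
  + by move=> i; exact: le_trans (ler_norm _) (ler_coord_norm _ _).
- move=> r [w [s [p [[s0 Kp] /= F0' G0' H]]]].
  have sV (W : normedModType R) (b c : W) : s^-1 *: (b + s *: c) = s^-1 *: b + c.
    by rewrite scalerDr scalerA mulVf ?gt_eqF// scale1r.
  rewrite leNgt; apply/negP => r0.
  apply: (no_descent (w := s^-1 *: w) dcrit).
  + by rewrite linearZ -sV -F0' scaler0.
  + rewrite linearZ -sV; have /eqP := G0'; rewrite eq_sym subr_eq0 => /eqP ->.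
    by apply: cone_ofZ; rewrite ?invr_gt0.
  + move=> i; have := le_lt_trans (H i) r0; rewrite subr0 => Hi.
    by rewrite linearZ -sV mxE pmulr_rlt0// invr_gt0.
have [g gE] : exists g : {linear Y -> R^o}, g =1 (fun y => - h y).
  by apply: linear_of => t u v; rewrite linearD linearZ /= opprD scalerN.
(* Each property of [g] follows from this inequality with s = 1, by varying only [b], only [w], only
   [p], or [b] together with [r]. *)
have key (b : 'rV[R]_m) (w : Z) s p r : 0 < s -> K p -> (forall i, - b ord0 i <= r) ->
    0 <= r + g (jac w) + s * g (hess d) - g (0, (0, p)) + g (b, 0).
  move=> s0 Kp br.
  have -> : r + g (jac w) + s * g (hess d) - g (0, (0, p)) + g (b, 0) =
      r + g (jac w + s *: hess d - (0, (0, p)) + (b, 0)).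
    by rewrite !linearD linearN linearZ /= !addrA.
  rewrite gE subr_ge0; apply: hX; exists w, s, p; split=> //=.
  - by rewrite subr0 addr0.
  - by rewrite addr0.
  - by move=> i; rewrite subr0 opprD addrA subrr add0r mxE.
have jac0 : g (jac 0) = 0.
  have -> : jac 0 = 0 by congr (_, (_, _)); exact: linear0.
  exact: linear0.
have g00 : g (0, (0, 0)) = 0 by exact: (linear0 g).
have g0 : g (0, 0) = 0 by exact: (linear0 g).
have gZ1 t a : g (t *: a, 0) = t * g (a, 0).
  have -> : (t *: a, 0) = t *: (a, 0) :> Y by congr (_, _); rewrite /= scaler0.
  exact: linearZ.
have jacZ t w : g (jac (t *: w)) = t * g (jac w).
  have -> : jac (t *: w) = t *: jac w by congr (_, (_, _)); exact: linearZ.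
  exact: linearZ.
have gpos a : orthant a -> 0 <= g (a, 0).
  move=> a0; apply: (affine_ge0 (A := g (hess d))) => t t0.
  have := key (t *: a) 0 1 0 0 ltr01 (cone_of0 QG).
  rewrite add0r jac0 add0r mul1r g00 subr0 gZ1; apply.
  by move=> i; rewrite mxE oppr_le0 mulr_ge0// ltW.
have g1 : g (const_mx 1, 0) = 1.
  (* Taking b = - t times the all-ones vector and r = t is admissible for t of either sign, which
     forces equality. *)
  have H t : 0 <= g (hess d) + t * (1 - g (const_mx 1, 0)).
    have := key ((- t) *: const_mx 1) 0 1 0 t ltr01 (cone_of0 QG).
    rewrite jac0 addr0 mul1r g00 subr0 gZ1 mulNr mulrBr mulr1 addrCA addrA.
    by apply => i; rewrite !mxE mulr1 opprK.
  apply/eqP; rewrite eq_le -subr_ge0 -[X in _ && X]subr_ge0; apply/andP; split.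
    by apply: (affine_ge0 (A := g (hess d))) => t _; exact: H.
  by apply: (affine_ge0 (A := g (hess d))) => t _; have := H (- t); lra.
have gjac w : g (jac w) = 0.
  have H t : 0 <= g (hess d) + t * g (jac w).
    have := key 0 (t *: w) 1 0 0 ltr01 (cone_of0 QG).
    rewrite add0r mul1r g00 subr0 ?g0 addr0 jacZ addrC.
    by apply => i; rewrite mxE oppr0.
  apply/eqP; rewrite eq_le -oppr_ge0; apply/andP; split.
    by apply: (affine_ge0 (A := g (hess d))) => t _; have := H (- t); lra.
  by apply: (affine_ge0 (A := g (hess d))) => t _; exact: H.
exists g; last first.
  have := key 0 0 1 0 0 ltr01 (cone_of0 QG).
  rewrite add0r jac0 add0r mul1r g00 subr0 ?g0 addr0; apply.
  by move=> i; rewrite mxE oppr0.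
split => //.
- move=> q Qq; rewrite -oppr_ge0; apply: (affine_ge0 (A := g (hess d))) => t t0.
  have := key 0 0 1 (t *: (q - G z0)) 0 ltr01.
  rewrite add0r jac0 add0r mul1r ?g0 addr0.
  have -> : (0, (0, t *: (q - G z0))) = t *: (0, (0, q - G z0)) :> Y.
    by congr (_, (_, _)); rewrite /= scaler0.
  rewrite linearZ mulrN; apply; last by move=> i; rewrite mxE oppr0.
  by exists t, q.
- move=> [x y]; have [w [Fw Gw] wle] := onto x y.
  have -> : g (0, (x, y)) = - g ('d I z0 w, 0).
    apply/eqP; rewrite -subr_eq0 opprK -linearD.
    have -> : (0, (x, y)) + ('d I z0 w, 0) = jac w.
      by rewrite /jac Fw Gw; congr (_, _); rewrite /= ?add0r ?addr0.
    by rewrite gjac.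
  rewrite normrN; apply: le_trans (functional_le_norm _ gpos g1) _.
  by apply: le_trans (kI w) _; rewrite -mulrA ler_pM2l.
Qed.

(** Multipliers of nearby critical directions share the bound [M], so their values at [hess d] are
    at least - e; [functional_limit] then gives one with a non-negative value. *)
Lemma closure_multiplier d : closure critical d ->
  exists M : R, exists2 g, multiplier M g & 0 <= g (hess d).
Proof.
move=> dcl; have [M HM] := exists_multiplier.
have M1 : 0 < 1 + `|M| by rewrite ltr_wpDr.
have [||g gle gh] := @functional_limit R Y (multiplier M) (hess d).
- move=> [a y]; exists (`|a| + M * `|y|) => g /multiplier_bound.
  by move=> /(_ a y); exact: le_trans (ler_norm _).
- move=> e e0; have e'0 : 0 < e / (1 + `|M|) by exact: divr_gt0.
  have [r1 r10 H1] := d2_diag_continuous d IC2 e'0.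
  have [r2 r20 H2] := d2_diag_continuous d FC2 e'0.
  have [r3 r30 H3] := d2_diag_continuous d GC2 e'0.
  pose r := Num.min r1 (Num.min r2 r3).
  have r0 : 0 < r by rewrite !lt_min r10 r20.
  have [d' [crit]] := dcl _ (nbhsx_ballx d _ r0).
  rewrite -ball_normE /= !lt_min => /andP[/H1 {}H1 /andP[/H2 {}H2 /H3 {}H3]].
  have [g gm gd'] := HM _ crit; exists g => //.
  suff le : `|g (hess d - hess d')| <= e.
    move: le; rewrite linearB => /ler_normlP[+ _]; rewrite opprB; lra.
  apply: le_trans (multiplier_bound _ _ gm) _.
  apply: (@le_trans _ _ (e / (1 + `|M|) + `|M| * (e / (1 + `|M|)))); last first.
    by rewrite -[X in X + _]mul1r -mulrDl mulrC divfK ?gt_eqF.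
  apply: lerD; first exact: H1.
  apply: le_trans (ler_wpM2r _ (ler_norm M)) _ => //.
  by rewrite ler_wpM2l// ge_max; apply/andP.
(* Bounds common to all multipliers pass to the limit; applied to v and - v they also transfer
   equalities. *)
have geq v (r : R) : (forall g', multiplier M g' -> g' v = r) -> g v = r.
  move=> H; apply/eqP; rewrite eq_le; apply/andP; split.
    by apply: gle => h /H ->.
  by rewrite -lerN2 -linearN; apply: gle => h /H; rewrite linearN => ->.
have gge v (r : R) : (forall g', multiplier M g' -> r <= g' v) -> r <= g v.
  by move=> H; rewrite -lerN2 -linearN; apply: gle => h /H; rewrite linearN lerN2.
exists M, g => //; split.
- by move=> a a0; apply: gge => h [+ _ _ _ _]; apply.
- by apply: geq => h [].
- by move=> w; apply: geq => h [_ _ + _ _]; apply.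
- by move=> q Qq; apply: gle => h [_ _ _ + _]; apply.
- move=> y; rewrite ler_norml; apply/andP; split.
    by apply: gge => h [_ _ _ _ /(_ y)]; rewrite ler_norml => /andP[].
  by apply: gle => h [_ _ _ _ /(_ y)]; rewrite ler_norml => /andP[].
Qed.
End multipliers.

(** * Passage between the hypotheses (A1)-(A3) and the abstract setting *)

Lemma C2_on_at (R : realType) (V W : normedModType R) (f : V -> W) (D : set V) (z : V) :
  nbhs z D -> C2_on D f -> C2_at f z.
Proof.
move=> Dz [df ddf bd ex _].
have Dz0 := nbhs_singleton Dz.
split.
- have /nbhs_ballP[r /= r0 rD] := Dz; exists r => // h hr; apply/df/rD.
  by rewrite -ball_normE /= opprD addNKr normrN.
- by move=> k; exact: ddf.
- have [B HB] := bd _ Dz0; exists `|B| => // h k; apply: le_trans (HB h k) _.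
  by rewrite !ler_wpM2r// ler_norm.
- by move=> e e0; exact: ex.
Qed.

(** Both [z] and z + t_k h_k are zeros of [f], so the first-order expansion divided by t_k makes
    f'(z) h_k small, and h_k tends to [h]. *)
Lemma contingent_cone_ker (R : realType) (V W : normedModType R) (f : V -> W) (z h : V) :
  C2_at f z -> f z = 0 ->
  contingent_cone [set y | f y = 0] z h -> 'd f z h = 0.
Proof.
move=> fC2 fz [t [hs [t0 tc hsc fk]]].
apply/eqP; rewrite -normr_le0; apply/ler_addgt0Pr => e e0; rewrite add0r.
have [k k0 kf] := linear_lipschitz (diff_continuous (C2_at_diff fC2)).
have N0 : 0 < `|h| + 1 by rewrite ltr_wpDl.
have e'0 : 0 < e / 2 / (`|h| + 1) by rewrite !divr_gt0.
have [r r0 sd] := strictly_differentiable fC2 e'0.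
have [n [hn1 hn2 tn]] : exists n, [/\ `|h - hs n| < 1, `|h - hs n| < e / 2 / k &
    t n < r / (`|h| + 1)].
  near \oo => n; exists n; split.
  - by near: n; exact: (cvgrPdist_lt _ _).1 hsc _ ltr01.
  - by near: n; apply: (cvgrPdist_lt _ _).1 hsc _ _; rewrite !divr_gt0.
  - have : `|0 - t n| < r / (`|h| + 1).
      by near: n; apply: (cvgrPdist_lt _ _).1 tc _ _; rewrite divr_gt0.
    by rewrite sub0r normrN gtr0_norm.
have hsN : `|hs n| <= `|h| + 1.
  rewrite -[hs n](subKr h); apply: le_trans (ler_normB _ _) _.
  by rewrite lerD2l ltW.
have tr : `|t n *: hs n| < r.
  rewrite normrZ gtr0_norm//; apply: le_lt_trans (ler_wpM2l (ltW (t0 n)) hsN) _.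
  by rewrite -ltr_pdivlMr.
have := sd z (t n *: hs n); rewrite subrr normr0 addrAC subrr add0r => /(_ r0 tr).
rewrite (fk n) fz subrr sub0r normrN linearZ !normrZ gtr0_norm// mulrCA ler_pM2l// => dle.
have le1 : `|'d f z (hs n)| <= e / 2.
  apply: le_trans dle _; rewrite -[leRHS](divfK (lt0r_neq0 N0)).
  by rewrite ler_wpM2l// ltW.
have le2 : `|'d f z (h - hs n)| <= e / 2.
  by apply: le_trans (kf _) _; rewrite mulrC -ler_pdivlMr// ltW.
rewrite -[h](subrK (hs n)) linearD; apply: le_trans (ler_normD _ _) _; lra.
Unshelve. all: by end_near. Qed.

Lemma interior_orthant (R : realType) m (v : 'rV[R]_m) :
  (forall i, 0 < v ord0 i) -> interior (@orthant R m) v.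
Proof.
move=> v0; apply/nbhs_ballP; exists (\big[Num.min/1]_i v ord0 i) => /=.
  exact: lt_bigmin.
move=> w; rewrite -ball_normE /= => vw i.
have : `|v ord0 i - w ord0 i| < v ord0 i.
  apply: lt_le_trans (bigmin_le _ i _); apply: le_lt_trans vw.
  by have := ler_coord_norm (v - w) i; rewrite !mxE.
by rewrite ltr_norml ltrBlDr ltrDl => /andP[_ /ltW].
Qed.

Lemma diff_partial1 (R : realType) (X U W : normedModType R) (F : X * U -> W) x0 u0 h :
  differentiable F (x0, u0) -> 'd (fun x => F (x, u0)) x0 h = 'd F (x0, u0) (h, 0).
Proof.
move=> dF; have dp : is_diff x0 (fun x : X => (x, u0)) (fun h => (h, 0 : U)).
  exact: is_diff_pair.
have -> : (fun x => F (x, u0)) = F \o (fun x : X => (x, u0)) by [].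
by rewrite diff_comp//= ?diff_val//; exact: ex_diff.
Qed.

Lemma pair_rVE (R : realType) m (f : {linear 'rV[R]_m -> R^o}) (a : 'rV[R]_m) :
  f a = pair_rV (\row_i f (delta_mx 0 i)) a.
Proof.
rewrite {1}(row_sum_delta a) linear_sum; apply: eq_bigr => i _.
by rewrite linearZ mxE mulrC.
Qed.

Lemma diff_lin_comp (R : realType) (V W : normedModType R) (P : {linear W -> R^o})
    (f : V -> W) (z : V) :
  continuous P -> differentiable f z -> is_diff z (P \o f : V -> R^o) (P \o 'd f z).
Proof.
move=> Pc df.
have dP : differentiable (P : W -> R^o) (f z) by exact: linear_differentiable.
apply: DiffDef; first exact: differentiable_comp.
by rewrite diff_comp// diff_lin.
Qed.

Lemma diff_lagrangian (R : realType) (V W1 W2 W3 : normedModType R)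
    (p1 : {linear W1 -> R^o}) (p2 : {linear W2 -> R^o}) (p3 : {linear W3 -> R^o})
    (f1 : V -> W1) (f2 : V -> W2) (f3 : V -> W3) (z h : V) :
  continuous p1 -> continuous p2 -> continuous p3 ->
  differentiable f1 z -> differentiable f2 z -> differentiable f3 z ->
  'd (fun y => p1 (f1 y) + p2 (f2 y) + p3 (f3 y)) z h =
  p1 ('d f1 z h) + p2 ('d f2 z h) + p3 ('d f3 z h).
Proof.
move=> c1 c2 c3 d1 d2 d3.
have i1 := diff_lin_comp c1 d1; have i2 := diff_lin_comp c2 d2.
have i3 := diff_lin_comp c3 d3.
have i12 := is_diffD i1 i2.
by rewrite (diff_val (is_diff_def := is_diffD i12 i3)).
Qed.

Theorem theorem4p1 (R : realType) (E0 E X U : completeNormedModType R) (m : nat)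
  (Q : set E) (I : (X * U)%type -> 'rV[R]_m) (F : (X * U)%type -> E0)
  (G : (X * U)%type -> E) (x0 : X) (u0 : U) :
  Q !=set0 -> closed Q -> @convex_set R E Q ->
  (* z0 = (x0,u0) is feasible *)
  F (x0, u0) = 0 -> Q (G (x0, u0)) ->
  (* (A1) *)
  (exists r1 r1' : R, [/\ 0 < r1, 0 < r1' &
     let O := [set z : X * U | ball x0 r1 z.1 /\ ball u0 r1' z.2] in
     [/\ C2_on O I, C2_on O F & C2_on O G]]) ->
  (* (A2) F_x(z0) bijective *)
  bijective ('d (fun x : X => F (x, u0)) x0 : X -> E0) ->
  (* (A3) *)
  ('d G (x0, u0) : (X * U)%type -> E) @`
     contingent_cone [set z | F z = 0] (x0, u0) = setT ->
  (* z0 is a locally weak Pareto solution of (MP2) *)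
  (exists2 eps : R, 0 < eps & forall z : X * U, F z = 0 -> Q (G z) ->
      `|z.1 - x0| <= eps -> `|z.2 - u0| <= eps ->
      ~ neg_set (interior (@orthant R m)) (I z - I (x0, u0))) ->
  forall d : X * U,
    closure [set d' : X * U |
       [/\ neg_set (@orthant R m) ('d I (x0, u0) d'),
           'd F (x0, u0) d' = 0
         & cone_of Q (G (x0, u0)) ('d G (x0, u0) d')]] d ->
    exists (lam : 'rV[R]_m) (v : {linear E0 -> R^o}) (e : {linear E -> R^o}),
      [/\ orthant lam /\ `|lam| = 1, dual_elem v /\ dual_elem e,
          (forall h : X * U,
             'd (fun z => pair_rV lam (I z) + v (F z) + e (G z)) (x0, u0) h = 0),
          normal_cone Q (G (x0, u0)) e
        & 0 <= pair_rV lam (d2 I (x0, u0) d d) + v (d2 F (x0, u0) d d)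
                 + e (d2 G (x0, u0) d d)].
Proof.
move=> _ _ Qc F0 QG [r1 [r1' [r10 r1'0]]] /=.
set D := [set z | _] => -[I2 F2 G2] Fx GT [eps eps0 wp] d dcl.
set z0 := (x0, u0) in F0 QG GT wp dcl *.
have Dz0 : nbhs z0 D.
  by exists (ball x0 r1, ball u0 r1') => //=; split; exact: nbhsx_ballx.
have {I2}IC2 := C2_on_at Dz0 I2; have {F2}FC2 := C2_on_at Dz0 F2.
have {G2}GC2 := C2_on_at Dz0 G2.
have dI := C2_at_diff IC2; have dF := C2_at_diff FC2; have dG := C2_at_diff GC2.
have [T TE] : exists T : {linear (X * U)%type -> (E0 * E)%type},
    T =1 (fun w => ('d F z0 w, 'd G z0 w)).
  by apply: linear_of => t a b; rewrite !linearP.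
have Tc : continuous T.
  have -> : (T : X * U -> E0 * E) = (fun w => ('d F z0 w, 'd G z0 w)) by apply/funext.
  by move=> w; apply: cvg_pair; exact: diff_continuous.
(* (A2) gives [a] with the right F-part; (A3) then repairs the G-part by some [h] in the contingent
   cone, which the derivative of [F] annihilates. *)
have Tsurj y : exists w, T w = y.
  case: y => x y.
  have [a aE] : exists a, 'd (fun x : X => F (x, u0)) x0 a = x.
    by have [f _ fK] := Fx; exists (f x).
  have [h hT hE] : (('d G z0 : (X * U)%type -> E) @`
      contingent_cone [set z | F z = 0] z0) (y - 'd G z0 (a, 0)) by rewrite GT.
  exists ((a, 0) + h); rewrite TE !linearD hE subrKC.
  by rewrite (contingent_cone_ker FC2 F0 hT) addr0 -diff_partial1// aE.
have [C C0 HC] := @open_mapping R (prod_complete X U) (prod_complete E0 E) T Tc Tsurj.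
have onto x y : exists2 w : X * U, ('d F z0 w = x) /\ ('d G z0 w = y) &
    `|w| <= C * Num.max `|x| `|y|.
  have [w + wle] := HC (x, y); rewrite TE => -[Fw Gw].
  by exists w; [split|exact: wle].
have wp' : exists2 eps : R, 0 < eps & forall z, F z = 0 -> Q (G z) ->
    `|z - z0| < eps -> ~ forall i, I z ord0 i < I z0 ord0 i.
  exists eps => // z Fz Qz; rewrite prod_normE gt_max => /andP[z1 z2] lt.
  apply: (wp z Fz Qz (ltW z1) (ltW z2)); exists (I z0 - I z); last by rewrite opprB.
  by apply: interior_orthant => i; rewrite !mxE subr_gt0.
have dcl' : closure (@critical R (prod_complete X U) E0 E m Q I F G z0) d.
  apply: closureS dcl => h [[v v0 vE] Fh Gh]; split=> // i.
  by rewrite -vE mxE oppr_le0.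
have [M [g [gpos g1 gjac gQ gM] gh]] :=
  @closure_multiplier R (prod_complete X U) E0 E m Q I F G z0 C
    Qc F0 QG IC2 FC2 GC2 C0 onto wp' d dcl'.
have gsplit a x y : g (a, (x, y)) = g (a, 0) + g (0, (x, 0)) + g (0, (0, y)).
  rewrite -!linearD; congr (g _).
  by congr (_, (_, _)); rewrite /= ?addr0 ?add0r.
have [g1' g1E] : exists f : {linear 'rV[R]_m -> R^o}, f =1 (fun a => g (a, 0)).
  apply: linear_of => t a b; rewrite -linearP; congr (g _).
  by congr (_, _); rewrite /= scaler0 addr0.
pose lam0 : 'rV[R]_m := \row_i g1' (delta_mx 0 i).
have gl a : g (a, 0) = pair_rV lam0 a by rewrite -g1E; exact: pair_rVE.
(* Dividing by [s] trades the condition that the coordinates sum to 1 for unit norm; that condition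
   also shows that [lam0] is non-zero. *)
pose s := `|lam0|.
have s0 : 0 < s.
  rewrite normr_gt0; apply/eqP => l0; move: g1; rewrite gl l0 /pair_rV big1.
    by move/eqP; rewrite eq_sym oner_eq0.
  by move=> i _; rewrite mxE mul0r.
have [v vE] : exists v : {linear E0 -> R^o}, v =1 (fun x => s^-1 * g (0, (x, 0))).
  apply: linear_of => t a b.
  have -> : (0, (t *: a + b, 0)) = t *: (0, (a, 0)) + (0, (b, 0)) :> 'rV[R]_m * (E0 * E).
    by congr (_, (_, _)); rewrite /= scaler0 addr0.
  by rewrite linearP mulrDr mulrCA.
have [e eE] : exists e : {linear E -> R^o}, e =1 (fun y => s^-1 * g (0, (0, y))).
  apply: linear_of => t a b.
  have -> : (0, (0, t *: a + b)) = t *: (0, (0, a)) + (0, (0, b)) :> 'rV[R]_m * (E0 * E).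
    by congr (_, (_, _)); rewrite /= scaler0 addr0.
  by rewrite linearP mulrDr mulrCA.
have vc : continuous v.
  apply: (@norm_le_linear_continuous _ _ _ _ (s^-1 * M)) => x.
  rewrite vE normrM gtr0_norm ?invr_gt0// -mulrA ler_pM2l ?invr_gt0//.
  have -> : `|x| = `|(x, 0) : E0 * E| by rewrite prod_normE /= normr0 max_l.
  exact: gM.
have ec : continuous e.
  apply: (@norm_le_linear_continuous _ _ _ _ (s^-1 * M)) => y.
  rewrite eE normrM gtr0_norm ?invr_gt0// -mulrA ler_pM2l ?invr_gt0//.
  have -> : `|y| = `|(0, y) : E0 * E| by rewrite prod_normE /= normr0 max_r.
  exact: gM.
pose lam := s^-1 *: lam0.
have lamE a : pair_rV lam a = s^-1 * g (a, 0).
  by rewrite gl /pair_rV mulr_sumr; apply: eq_bigr => i _; rewrite mxE mulrA.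
have [P PE] : exists P : {linear 'rV[R]_m -> R^o}, P =1 pair_rV lam.
  apply: linear_of => t a b; rewrite !lamE -!g1E linearP mulrDr.
  by rewrite [s^-1 * _]mulrCA.
have Pc : continuous P.
  apply: (@norm_le_linear_continuous _ _ _ _ s^-1) => a.
  rewrite PE lamE normrM gtr0_norm ?invr_gt0// ler_pM2l ?invr_gt0//.
  exact: functional_le_norm.
have tot a x y : pair_rV lam a + v x + e y = s^-1 * g (a, (x, y)).
  by rewrite lamE vE eE (gsplit a x y) !mulrDr.
exists lam, v, e; split=> //.
- split.
    move=> i; rewrite mxE mulr_ge0 ?invr_ge0 ?(ltW s0)// mxE g1E; apply: gpos => j.
    by rewrite mxE; case: eqP => //; case: eqP.
  by rewrite normrZ gtr0_norm ?invr_gt0// mulVf ?gt_eqF.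
- move=> h.
  have -> : (fun z => pair_rV lam (I z) + v (F z) + e (G z)) =
      (fun z => P (I z) + v (F z) + e (G z)) by apply/funext => z; rewrite PE.
  rewrite diff_lagrangian// PE tot -[RHS](mulr0 s^-1); congr (_ * _).
  exact: gjac.
- by move=> q Qq; rewrite eE pmulr_rle0 ?invr_gt0//; exact: gQ.
- by rewrite tot mulr_ge0// invr_ge0 ltW.
Qed.
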